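(* Let $N\ge 2$ and suppose that $V\in C^{1}(\mathbb{R}^{N}\setminus\{0\},\mathbb{R})$ satisfies: (V1) $V(-x)=V(x)$ for all $x\in\mathbb{R}^{N}\setminus\{0\}$; (V2) $V(x)<0$ for all $x\in\mathbb{R}^{N}\setminus\{0\}$; (V3) $2V(x)+(x,\nabla V(x))\to 0$ as $|x|\to+\infty$; (V4) $2V(x)+(x,\nabla V(x))\to+\infty$ as $|x|\to 0$; (V5) $-V(x)\to+\infty$ as $|x|\to 0$; (V6) $V(x)\to 0$ as $|x|\to+\infty$. Then for any $H>0$ there is at least one hyperbolic orbit for the system $$\ddot u(t)+\nabla V(u(t))=0,\qquad \tfrac12|\dot u(t)|^{2}+V(u(t))=H .$$
   Context: $(\cdot,\cdot)$ is the standard Euclidean inner product on $\mathbb{R}^N$ and $|\cdot|$ the induced norm. A solution of the system is a function $u:\mathbb{R}\to\mathbb{R}^N\setminus\{0\}$ of class $C^2$ satisfying both equations for all $t\in\mathbb{R}$. A solution $u$ is called a hyperbolic orbit if, as $|t|\to+\infty$, $|u(t)|\to+\infty$ and $|\dot u(t)|>0$ in the limit, i.e. $\liminf_{|t|\to\infty}|\dot u(t)|>0$ (as opposed to a parabolic orbit, for which $|u(t)|\to+\infty$ and $|\dot u(t)|\to 0$). *)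

(* Defs.v *)
From HB Require Import structures.
From mathcomp Require Export all_boot all_order all_algebra.
From mathcomp Require Export all_classical all_reals all_analysis.

Set Implicit Arguments.
Unset Strict Implicit.
Unset Printing Implicit Defensive.

Export Order.TTheory GRing.Theory Num.Theory.
Export numFieldNormedType.Exports.

Open Scope ring_scope.
Open Scope classical_set_scope.


(* The library norm `|x| on 'rV[R]_N is the sup norm; the Euclidean norm is
   [enorm].  The two norms induce the same topology, so differentiability,
   continuity and the filter 0^' on 'rV[R]_N have their usual meaning. *)
Definition edot (R : realType) (N : nat) (x y : 'rV[R]_N) : R :=
  \sum_(i < N) x 0 i * y 0 i.

Definition enorm (R : realType) (N : nat) (x : 'rV[R]_N) : R :=
  Num.sqrt (edot x x).

Definition gradient (R : realType) (N : nat) (V : 'rV[R]_N -> R)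
    (x : 'rV[R]_N) : 'rV[R]_N :=
  \row_(i < N) 'D_(delta_mx 0 i) V x.

(* V is a total function, but its value at 0 is never used. *)
Definition C1_punctured (R : realType) (N : nat) (V : 'rV[R]_N -> R) : Prop :=
  forall x : 'rV[R]_N, x != 0 ->
    differentiable V x /\ {for x, continuous (gradient V)}.

(* The filter "nrm x --> +oo", for example "|x| --> +oo" on 'rV[R]_N when nrm is
   [enorm]. *)
Definition norm_infty (R : realType) (T : Type) (nrm : T -> R) : set_system T :=
  filter_from setT (fun M : R => [set x | M < nrm x]).

#[global] Instance norm_infty_filter (R : realType) (T : Type) (nrm : T -> R) :
  Filter (norm_infty nrm).
Proof.
apply: filter_from_filter => [|M M' _ _]; first by exists 0.
by exists (Num.max M M') => // x /=; rewrite gt_max => /andP[].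
Qed.

(* The two-sided limit "|t| --> +oo" on R. *)
Definition abs_infty (R : realType) : set_system R :=
  norm_infty (fun t : R => `|t|).
Arguments abs_infty : clear implicits.

#[global] Instance abs_infty_filter (R : realType) : Filter (abs_infty R).
Proof. exact: norm_infty_filter. Qed.

Definition C2_curve (R : realType) (N : nat) (u : R -> 'rV[R]_N) : Prop :=
  [/\ forall t : R, derivable u t 1,
      forall t : R, derivable (derive1 u) t 1
    & continuous (derive1n 2 u)].

Definition solution (R : realType) (N : nat) (V : 'rV[R]_N -> R) (H : R)
    (u : R -> 'rV[R]_N) : Prop :=
  [/\ forall t : R, u t != 0,
      C2_curve u,
      forall t : R, derive1n 2 u t + gradient V (u t) = 0
    & forall t : R, 2^-1 * enorm (derive1 u t) ^+ 2 + V (u t) = H].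

Definition hyperbolic_orbit (R : realType) (N : nat) (V : 'rV[R]_N -> R)
    (H : R) (u : R -> 'rV[R]_N) : Prop :=
  [/\ solution V H u,
      enorm (u t) @[t --> abs_infty R] --> +oo
    & (0 < limf_einf (fun t : R => (enorm (derive1 u t))%:E) (abs_infty R))%E].

(* Main.v *)
Require Import Defs.
From mathcomp Require Import ring lra.

(** Along a solution of energy H,
      (|u|^2)'' = 2 (|u'|^2 - (u, grad V(u)))
                = 2 (2 H - (2 V(u) + (u, grad V(u)))),
    and by (V3) and (V6) there is a radius beyond which
    |2 V(x) + (x, grad V(x))| < H and |V(x)| < 1.  There |u|^2 is strictly
    convex: its second derivative lies between 2 H and 6 H.  An orbit that
    starts beyond this radius with velocity orthogonal to its position, which
    is possible because N >= 2, therefore satisfies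
      |u(0)|^2 + H t^2 <= |u(t)|^2 <= |u(0)|^2 + 3 H t^2
    for all times, past and future.  It never comes near the singularity and
    it escapes to infinity; since V < 0, its speed stays above sqrt(2 H).

    What remains is to produce the solution.  The gradient is only continuous,
    so this calls for a Peano theorem, and for one that gives solutions on all
    of the real line.  [peano] is stated for time-dependent fields that have,
    on each bounded time interval, a bounded support in space.  Its proof takes
    a pointwise cluster point of Euler polygons: equicontinuity of the polygons
    is enough for the differential equation to pass to the limit, without
    uniform convergence or integrals.

    The field (v, - grad V(x)) is made to fit by a cutoff which equals 1 as long
    as |x|^2 and |v|^2 obey the bounds above with some room ([margin] >= 0) and
    vanishes near x = 0 and for large x or v.  The estimates [a_priori] hold as
    long as the margin is nonnegative, and they make it positive; a first-exit
    argument ([positive_of_first_exit]) concludes that the cutoff is 1 along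
    the whole orbit ([escape]).  Negative times follow by reversing time. *)

Set Implicit Arguments.
Unset Strict Implicit.
Unset Printing Implicit Defensive.

(** * A global Peano theorem *)

Section Peano.
Variables (R : realType) (E : normedModType R).
Implicit Types (G : R -> E -> E) (y : E).

Fixpoint euler G (h : R) (y0 : E) (k : nat) : E :=
  if k is j.+1 then euler G h y0 j + h *: G (j%:R * h) (euler G h y0 j) else y0.

(** Each Euler step moves by h times a value of the field; if these values stay
    within e of g, the total displacement is that of the constant field g, up
    to e times the elapsed time. *)
Lemma euler_increment G y0 (g : E) (h e : R) (j k : nat) :
  0 <= h -> (j <= k)%N ->
  (forall i, (j <= i < k)%N -> `|G (i%:R * h) (euler G h y0 i) - g| <= e) ->
  `|euler G h y0 k - euler G h y0 j - ((k%:R - j%:R) * h) *: g|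
    <= (k%:R - j%:R) * h * e.
Proof.
move=> h0; elim: k => [|k IH].
  by rewrite leqn0 => /eqP -> _; rewrite !subrr !mul0r scale0r subr0 normr0.
rewrite leq_eqVlt => /predU1P[-> _|].
  by rewrite !subrr !mul0r scale0r subr0 normr0.
rewrite ltnS => jk Ge.
have IHk : `|euler G h y0 k - euler G h y0 j - ((k%:R - j%:R) * h) *: g|
    <= (k%:R - j%:R) * h * e.
  by apply: IH => // i /andP[ji ik]; apply: Ge; rewrite ji ltnW.
have Gk : `|G (k%:R * h) (euler G h y0 k) - g| <= e by apply: Ge; rewrite jk /=.
rewrite /= -natr1; set a := euler G h y0 k in IHk Gk *.
set b := G _ _ in Gk *; set c := euler G h y0 j in IHk *.
have -> : a + h *: b - c - ((k%:R + 1 - j%:R) * h) *: g =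
    (a - c - ((k%:R - j%:R) * h) *: g) + h *: (b - g).
  have -> : (k%:R + 1 - j%:R) * h = (k%:R - j%:R) * h + h by ring.
  by rewrite scalerBr scalerDl opprD [a + _ - c]addrAC addrACA.
apply: le_trans (ler_normD _ _) _.
have -> : (k%:R + 1 - j%:R) * h * e = (k%:R - j%:R) * h * e + h * e by ring.
by apply: lerD => //; rewrite normrZ ger0_norm// ler_wpM2l.
Qed.

(** The functions bounded by B form a compact set for pointwise convergence
    (Tychonoff), so the sequence clusters there.  Two evaluation points are
    controlled by the same index, which is what the comparison of increments
    in [peano_forward] needs. *)
Lemma compact_pointwise_cluster (z : nat -> R -> E) (B : R -> R) :
  (forall r : R, compact [set x : E | `|x| <= r]) ->
  (forall n t, `|z n t| <= B t) ->
  exists y : R -> E, forall (s t eta : R) (n0 : nat), 0 < eta ->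
    exists n, [/\ (n0 <= n)%N, `|z n s - y s| < eta & `|z n t - y t| < eta].
Proof.
move=> cpt zB.
have cK : compact [set f : prod_topology (fun _ : R => E) |
    forall t, [set x : E | `|x| <= B t] (f t)].
  apply: (@tychonoff R (fun _ => E) (fun t => [set x : E | `|x| <= B t])) => t.
  exact: cpt.
have [y [_ cly]] : [set f : prod_topology (fun _ : R => E) |
    forall t, [set x : E | `|x| <= B t] (f t)] `&`
    cluster ((z : nat -> prod_topology (fun _ : R => E)) @ \oo) !=set0.
  by apply: cK; exists 0%N => // n _ t; exact: zB.
exists y => s t eta n0 eta0.
have nb r : nbhs y [set f : prod_topology (fun _ : R => E) | `|f r - y r| < eta].
  have yr : nbhs (proj r y) (ball (y r) eta) by exact: nbhsx_ballx.
  have := @proj_continuous R (fun _ => E) r y _ yr.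
  rewrite nbhs_simpl /=.
  apply: (@filterS _ (nbhs y)) => f /=.
  by rewrite /proj -ball_normE /= distrC.
have nn0 : ((z : nat -> prod_topology (fun _ : R => E)) @ \oo)
    (z @` [set n | (n0 <= n)%N]).
  by exists n0 => // n /= n0n; exists n.
have [_ [[n /= n0n <-] [? ?]]] := cly _ _ nn0 (filterI (nb s) (nb t)).
by exists n.
Qed.

Lemma truncn_node (h r : R) : 0 < h -> 0 <= r ->
  (Num.truncn (r / h))%:R * h <= r < (Num.truncn (r / h))%:R * h + h.
Proof.
move=> h0 r0; have /truncn_itv/andP[] : 0 <= r / h by rewrite divr_ge0// ltW.
rewrite ler_pdivlMr// ltr_pdivrMr// -natr1 mulrDl mul1r.
by move=> -> ->.
Qed.

(** The polygon read at times s and t through the nodes just before them.  The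
    nodes in between are within |t - s| + h of s, and the polygon is
    M-Lipschitz, so closeness of the field to g on this small box is enough.
    Reading at nodes instead of at s and t costs the terms in h. *)
Lemma euler_local G y0 (h M T e s t : R) (g : E)
    (j := Num.truncn (s / h)) (k := Num.truncn (t / h)) :
  0 < h -> 0 <= s <= T -> 0 <= t <= T -> 0 <= e ->
  (forall r x, 0 <= r <= T -> `|G r x| <= M) ->
  (forall r x, `|r - s| <= `|t - s| + h ->
     `|x - euler G h y0 j| <= (`|t - s| + h) * M -> `|G r x - g| <= e) ->
  `|euler G h y0 k - euler G h y0 j - (t - s) *: g|
    <= (`|t - s| + h) * e + h * `|g|.
Proof.
move=> h0 /andP[s0 sT] /andP[t0 tT] e0 GM Gg.
have M0 : 0 <= M.
  apply: le_trans (GM 0 0 _); first exact: normr_ge0.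
  by rewrite lexx (le_trans s0).
have /andP[js sj] := truncn_node h0 s0; have /andP[kt tk] := truncn_node h0 t0.
rewrite -/j in js sj; rewrite -/k in kt tk.
have node_mono (i l : nat) : (i <= l)%N -> i%:R * h <= l%:R * h.
  by move=> il; apply: ler_wpM2r; [exact: ltW|rewrite ler_nat].
have node_lt (i l : nat) : (i < l)%N -> i%:R * h + h <= l%:R * h.
  by move=> /node_mono; rewrite -natr1 mulrDl mul1r.
have [ts1 ts2] : t - s <= `|t - s| /\ s - t <= `|t - s|.
  by split; [exact: ler_norm|rewrite distrC; exact: ler_norm].
have lip (i l : nat) : (i <= l)%N -> l%:R * h <= T ->
    `|euler G h y0 l - euler G h y0 i| <= (l%:R - i%:R) * h * M.
  move=> il lT; have := @euler_increment G y0 0 h M i l (ltW h0) il.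
  rewrite scaler0 subr0; apply => a /andP[ia al]; rewrite subr0; apply: GM.
  apply/andP; split; first by rewrite mulr_ge0// ltW.
  exact: le_trans (node_mono _ _ (ltnW al)) lT.
have incr : `|euler G h y0 k - euler G h y0 j - ((k%:R - j%:R) * h) *: g|
    <= (`|t - s| + h) * e.
  have [jk|kj] := leqP j k.
    apply: le_trans (euler_increment (ltW h0) jk (e := e) _) _.
      move=> i /andP[ji ik]; have := node_mono _ _ ji; have := node_lt _ _ ik.
      move=> ik' ji'; apply: Gg; first by rewrite ler_norml; apply/andP; split; lra.
      apply: le_trans (lip _ _ ji _) _; first lra.
      by apply: ler_wpM2r => //; rewrite mulrBl; lra.
    by apply: ler_wpM2r => //; rewrite mulrBl; lra.
  have -> : euler G h y0 k - euler G h y0 j - ((k%:R - j%:R) * h) *: g =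
      - (euler G h y0 j - euler G h y0 k - ((j%:R - k%:R) * h) *: g).
    by rewrite -[j%:R - k%:R]opprB mulNr scaleNr opprK opprD opprB.
  rewrite normrN.
  apply: le_trans (euler_increment (ltW h0) (ltnW kj) (e := e) _) _.
    move=> i /andP[ki ij]; have := node_mono _ _ ki; have := node_lt _ _ ij.
    move=> ij' ki'; apply: Gg; first by rewrite ler_norml; apply/andP; split; lra.
    rewrite distrC; apply: le_trans (lip _ _ (ltnW ij) _) _; first lra.
    by apply: ler_wpM2r => //; rewrite mulrBl; lra.
  by apply: ler_wpM2r => //; rewrite mulrBl; lra.
have -> : euler G h y0 k - euler G h y0 j - (t - s) *: g =
    (euler G h y0 k - euler G h y0 j - ((k%:R - j%:R) * h) *: g) +
    ((k%:R - j%:R) * h - (t - s)) *: g.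
  by rewrite [(_ * h - _) *: g]scalerBl subrKA.
apply: le_trans (ler_normD _ _) _; apply: lerD => //.
rewrite normrZ ler_wpM2r// ler_norml mulrBl; apply/andP; split; lra.
Qed.

(** The conclusion is differentiability in increment form, one-sided at 0, so
    that two such half-solutions can be glued without one-sided derivatives. *)
Lemma peano_forward G y0 :
  (forall r : R, compact [set x : E | `|x| <= r]) ->
  (forall s y e, 0 < e -> exists2 d, 0 < d & forall t x,
     `|t - s| < d -> `|x - y| < d -> `|G t x - G s y| <= e) ->
  (forall T, exists M, forall t x, 0 <= t <= T -> `|G t x| <= M) ->
  exists2 y : R -> E, y 0 = y0 &
    forall s e, 0 <= s -> 0 < e -> exists2 d, 0 < d & forall t,
      0 <= t -> `|t - s| < d ->
      `|y t - y s - (t - s) *: G s (y s)| <= e * `|t - s|.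
Proof.
move=> cpt Gc /choice[M GM].
pose h n : R := n.+1%:R^-1.
have h0 n : 0 < h n by rewrite invr_gt0.
pose z n t := euler G (h n) y0 (Num.truncn (t / h n)).
have z0 n : z n 0 = y0 by rewrite /z mul0r truncn0.
have zB n t : `|z n t| <= `|y0| + `|t| * `|M t|.
  have [t0|t0] := leP 0 t; last first.
    rewrite /z (_ : Num.truncn _ = 0%N) /=; first by rewrite lerDl mulr_ge0.
    by apply/truncn0Pn; rewrite -ltNge (lt_trans _ ltr01)// pmulr_llt0// invr_gt0.
  have /andP[kt _] := truncn_node (h0 n) t0.
  have := @euler_increment G y0 0 (h n) `|M t| 0 (Num.truncn (t / h n)).
  rewrite scaler0 !subr0 => /(_ (ltW (h0 n)) isT) incr.
  rewrite /z -[euler _ _ _ _](subrK y0) addrC (le_trans (ler_normD _ _))// lerD2l.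
  apply: le_trans (incr _) _.
    move=> i ik; rewrite subr0; apply: le_trans (GM _ _ _ _) (ler_norm _).
    apply/andP; split; first by rewrite mulr_ge0// ltW.
    apply: le_trans kt; apply: ler_wpM2r; first exact: ltW.
    by rewrite ler_nat ltnW.
  by rewrite ler_wpM2r// (le_trans kt)// ler_norm.
have [y zy] := compact_pointwise_cluster cpt zB.
exists y.
  apply/eqP; rewrite -subr_eq0 -normr_le0; apply/ler_addgt0Pl => e e0.
  have [n [_ + _]] := zy 0 0 e 0%N e0.
  by rewrite z0 distrC addr0 => /ltW.
move=> s e s0 e0.
have [d d0 Gd] := Gc s (y s) e e0.
pose T := s + 1; pose K := `|M T|.
have K0 : 0 <= K by exact: normr_ge0.
pose d1 := Num.min 1 (d / (4 * (K + 1))).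
have d10 : 0 < d1 by rewrite lt_min ltr01 divr_gt0// mulr_gt0// ltr_wpDl.
have d1K : d1 * (4 * (K + 1)) <= d.
  by rewrite -ler_pdivlMr ?ge_min ?lexx ?orbT// mulr_gt0// ltr_wpDl.
have d11 : d1 <= 1 by rewrite ge_min lexx.
clearbody d1.
exists d1 => // t t0 tsd1.
have tT : 0 <= t <= T.
  rewrite t0 /=; have : t - s <= `|t - s| := ler_norm _.
  rewrite /T; lra.
set g := G s (y s).
apply/ler_addgt0Pl => eta eta0.
(* step and cluster errors of size mu contribute at most
   2 mu + mu e + mu |g| to the increment, hence less than eta *)
pose mu := Num.min (eta / (3 + e + `|g|)) (Num.min d1 (d / 2)).
have C0 : 0 < 3 + e + `|g|.
  by have := normr_ge0 g; lra.
have mu0 : 0 < mu by rewrite !lt_min d10 !divr_gt0.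
have mueta : mu * (3 + e + `|g|) <= eta.
  by rewrite -ler_pdivlMr// ge_min lexx.
have mud1 : mu <= d1 by rewrite !ge_min lexx orbT.
have mud : mu <= d / 2 by rewrite !ge_min lexx !orbT.
have [n [n0n zs zt]] := zy s t mu (Num.truncn mu^-1) mu0.
have hmu : h n <= mu.
  rewrite /h -[leRHS]invrK lef_pV2 ?posrE ?invr_gt0//.
  apply: ltW; apply: lt_le_trans (truncnS_gt _) _.
  by rewrite ler_nat ltnS.
have loc : `|z n t - z n s - (t - s) *: g| <=
    (`|t - s| + h n) * e + h n * `|g|.
  apply: (@euler_local G y0 (h n) K T e s t g) => //.
  - by rewrite s0 /T; lra.
  - exact: ltW.
  - by move=> r x rT; apply: le_trans (ler_norm _); exact: GM.
  - move=> r x rs xs; apply: Gd.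
      apply: le_lt_trans rs _.
      have : d1 * (4 * (K + 1)) = 4 * d1 + 4 * (d1 * K) by ring.
      have : 0 <= d1 * K by rewrite mulr_ge0// ltW.
      lra.
    rewrite -(subrKA (z n s)).
    apply: le_lt_trans (ler_normD _ _) _.
    have : (`|t - s| + h n) * K <= (2 * d1) * K by rewrite ler_wpM2r//; lra.
    have : d1 * (4 * (K + 1)) = 4 * d1 + 2 * (2 * d1 * K) by ring.
    move: xs; rewrite -/(z n s); lra.
have -> : y t - y s - (t - s) *: g =
    (z n t - z n s - (t - s) *: g) + ((z n s - y s) - (z n t - y t)).
  rewrite [RHS]addrAC; congr (_ - _).
  by rewrite opprB addrA subrKA [RHS]addrC subrKA.
apply: le_trans (ler_normD _ _) _.
have : `|z n s - y s - (z n t - y t)| <= 2 * mu.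
  by apply: le_trans (ler_normB _ _) _; lra.
have : h n * e <= mu * e by rewrite ler_wpM2r// ltW.
have : h n * `|g| <= mu * `|g| by rewrite ler_wpM2r.
nra.
Qed.

Lemma is_derive_increment (y : R -> E) (s : R) (g : E) :
  (forall e, 0 < e -> exists2 d, 0 < d & forall t, `|t - s| < d ->
     `|y t - y s - (t - s) *: g| <= e * `|t - s|) ->
  is_derive (s : R) 1 y g.
Proof.
move=> yg.
have lim : h^-1 *: (y (h *: 1 + s) - y s) @[h --> 0^'] --> g.
  apply/cvgrPdist_le => e e0.
  have [d d0 dy] := yg e e0.
  near=> h.
  have h0 : h != 0 by near: h; exact: nbhs_dnbhs_neq.
  have hd : `|h| < d by near: h; exact: dnbhs0_lt.
  have := dy (h + s); rewrite addrK => /(_ hd) le.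
  rewrite [h *: 1]mulr1 distrC.
  have -> : h^-1 *: (y (h + s) - y s) - g = h^-1 *: (y (h + s) - y s - h *: g).
    by rewrite [RHS]scalerBr scalerA mulVf// scale1r.
  by rewrite normrZ normfV mulrC ler_pdivrMr ?normr_gt0.
apply: DeriveDef; first by apply/cvg_ex; exists g.
exact: cvg_lim lim.
Unshelve. all: by end_near. Qed.

Lemma bounded_of_compact_support G :
  (forall r : R, compact [set x : E | `|x| <= r]) ->
  continuous (fun p : R * E => G p.1 p.2) ->
  (forall T, exists B, forall t y, `|t| <= T -> B < `|y| -> G t y = 0) ->
  forall T, exists M, forall t y, `|t| <= T -> `|G t y| <= M.
Proof.
move=> cpt Gc Gs T; have [B GB] := Gs T.
have cT : compact [set t : R | `|t| <= T].
  rewrite (_ : [set t | _] = `[(- T), T]%classic); first exact: segment_compact.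
  by apply/seteqP; split=> t /=; rewrite in_itv /= ler_norml.
have : compact ((fun p : R * E => G p.1 p.2) @`
    ([set t : R | `|t| <= T] `*` [set x : E | `|x| <= B])).
  apply: continuous_compact; last exact: compact_setX.
  exact: continuous_subspaceT.
move=> /compact_bounded[M [_ /(_ (M + 1))]]; rewrite ltrDl => /(_ ltr01) MG.
exists (Num.max (M + 1) 0) => t y tT; rewrite le_max.
have [yB|/(GB _ _ tT) ->] := leP `|y| B; last by rewrite normr0 lexx orbT.
by apply/orP; left; apply: MG; exists (t, y).
Qed.

(** The solution for negative times is the forward solution of the
    time-reversed field - G (- t). *)
Theorem peano G (y0 : E) :
  (forall r : R, compact [set x : E | `|x| <= r]) ->
  continuous (fun p : R * E => G p.1 p.2) ->
  (forall T, exists B, forall t y, `|t| <= T -> B < `|y| -> G t y = 0) ->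
  exists2 y : R -> E, y 0 = y0 & forall t : R, is_derive t 1 y (G t (y t)).
Proof.
move=> cpt Gc Gs.
have Gb := bounded_of_compact_support cpt Gc Gs.
have Geps s y e : 0 < e -> exists2 d, 0 < d & forall t x,
    `|t - s| < d -> `|x - y| < d -> `|G t x - G s y| <= e.
  move=> e0; have /cvgrPdist_le/(_ e e0) := Gc (s, y).
  move=> /nbhs_ballP[d /= d0 dG]; exists d => // t x ts xy.
  rewrite distrC; apply: (dG (t, x)).
  by split; rewrite -ball_normE /= distrC.
have [||y1 y10 y1P] := @peano_forward G y0 cpt.
- exact: Geps.
- by move=> T; have [M GM] := Gb T; exists M => t y /andP[? ?]; rewrite GM// ger0_norm.
have [||y2 y20 y2P] := @peano_forward (fun t y => - G (- t) y) y0 cpt.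
- move=> s y e /(Geps (- s) y)[d d0 dG]; exists d => // t x ts xy.
  by rewrite -opprD normrN dG// -opprD normrN.
- move=> T; have [M GM] := Gb T; exists M => t y /andP[? ?].
  by rewrite normrN GM// normrN ger0_norm.
exists (fun t => if 0 <= t then y1 t else y2 (- t)); first by rewrite lexx.
move=> s; apply: is_derive_increment => e e0 /=.
have y2P' : s <= 0 -> exists2 d, 0 < d & forall t, t <= 0 -> `|t - s| < d ->
      `|y2 (- t) - y2 (- s) - (t - s) *: G s (y2 (- s))| <= e * `|t - s|.
  move=> s0; have [|d d0 dy] := y2P (- s) e _ e0; first by rewrite oppr_ge0.
  exists d => // t t0 ts; have := dy (- t); rewrite oppr_ge0 opprK => /(_ t0).
  have -> : - t + s = - (t - s) by rewrite opprB addrC.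
  by rewrite normrN scaleNr scalerN opprK; exact.
have [s0|s0|s0] := ltgtP 0 s.
- have [d d0 dy] := y1P s e (ltW s0) e0.
  exists (Num.min d s); first by rewrite lt_min d0.
  move=> t; rewrite lt_min => /andP[td ts].
  have t0 : 0 <= t by have := ler_norm (s - t); rewrite distrC; lra.
  by rewrite t0; exact: dy.
- have [d d0 dy] := y2P' (ltW s0).
  exists (Num.min d (- s)); first by rewrite lt_min d0 oppr_gt0.
  move=> t; rewrite lt_min => /andP[td ts].
  have t0 : t < 0 by have := ler_norm (t - s); lra.
  by rewrite (lt_geF t0); apply: dy => //; exact: ltW.
- rewrite -{}s0 in y2P' *; rewrite y10.
  have [d1 d10 dy1] := y1P 0 e (lexx 0) e0.
  have [d2 d20 dy2] := y2P' (lexx 0).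
  exists (Num.min d1 d2); first by rewrite lt_min d10.
  move=> t; rewrite lt_min => /andP[td1 td2]; case: ifPn => t0.
    by have := dy1 t t0 td1; rewrite y10.
  have := dy2 t _ td2; rewrite oppr0 y20; apply.
  by rewrite ltW// ltNge.
Qed.
End Peano.

(** * Calculus of the Euclidean inner product and of real functions *)

Section EuclideanCalculus.
Variables (R : realType) (N : nat).
Implicit Types (x y : 'rV[R]_N) (u w : R -> 'rV[R]_N).

Lemma edotC x y : edot x y = edot y x.
Proof. by apply: eq_bigr => i _; rewrite mulrC. Qed.

Lemma edotZl (c : R) x y : edot (c *: x) y = c * edot x y.
Proof. by rewrite /edot mulr_sumr; apply: eq_bigr => i _; rewrite mxE mulrA. Qed.

Lemma edotNl x y : edot (- x) y = - edot x y.
Proof. by rewrite -scaleN1r edotZl mulN1r. Qed.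

Lemma edotNr x y : edot x (- y) = - edot x y.
Proof. by rewrite edotC edotNl edotC. Qed.

Lemma edot0l y : edot 0 y = 0.
Proof. by rewrite -(scale0r 0) edotZl mul0r. Qed.

Lemma edot_ge0 x : 0 <= edot x x.
Proof. by apply: sumr_ge0 => i _; rewrite -expr2 sqr_ge0. Qed.

Lemma sqr_enorm x : enorm x ^+ 2 = edot x x.
Proof. by rewrite /enorm sqr_sqrtr// edot_ge0. Qed.

Lemma edot_delta (i j : 'I_N) :
  edot (delta_mx 0 i : 'rV[R]_N) (delta_mx 0 j) = (i == j)%:R.
Proof.
rewrite /edot (bigD1 i)//= !mxE !eqxx mul1r /= big1 ?addr0 => [|k ki].
  by [].
by rewrite !mxE (negPf ki) andbF mul0r.
Qed.

(** Bounds for the Euclidean norm thus bound the sup norm that defines the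
    topology; the crude form avoids a square root. *)
Lemma norm_le_edot x : `|x| <= 1 + edot x x.
Proof.
rewrite [leLHS]/Num.Def.normr/= mx_normrE.
have e0 := edot_ge0 x.
apply: bigmax_le => [|[i j] _]; first by rewrite ler_wpDr.
rewrite ord1 /=; apply: (@le_trans _ _ (1 + x 0 j * x 0 j)).
  rewrite -expr2 -real_normK ?num_real//; nra.
rewrite lerD2l /edot (bigD1 j)//= lerDl.
by apply: sumr_ge0 => k _; rewrite -expr2 sqr_ge0.
Qed.

Lemma cvg_edot (T : Type) (F : set_system T) {FF : Filter F}
    (f g : T -> 'rV[R]_N) x y :
  f t @[t --> F] --> x -> g t @[t --> F] --> y ->
  edot (f t) (g t) @[t --> F] --> edot x y.
Proof.
move=> fx gy; rewrite /edot.
apply: (cvg_big (@add_continuous R)) => i _.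
have fi : f t 0 i @[t --> F] --> x 0 i.
  exact: (cvg_comp _ _ fx (@coord_continuous R 1 N 0 i x)).
have gi : g t 0 i @[t --> F] --> y 0 i.
  exact: (cvg_comp _ _ gy (@coord_continuous R 1 N 0 i y)).
exact: cvgM fi gi.
Qed.

Lemma is_derive_coord u (t : R) du i :
  is_derive t 1 u du -> is_derive t 1 (fun s => u s 0 i) (du 0 i).
Proof.
move=> ud; have dut : derivable u t 1 by [].
apply: DeriveDef; first exact: (derivable_mxP _ _ _).1.
have := derive_mx dut; rewrite derive_val => ->; by rewrite mxE.
Qed.

Lemma is_derive_edot u w (t : R) du dw :
  is_derive t 1 u du -> is_derive t 1 w dw ->
  is_derive t 1 (fun s => edot (u s) (w s)) (edot du (w t) + edot (u t) dw).
Proof.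
move=> ud wd; rewrite /edot.
have -> : (fun s => \sum_(i < N) u s 0 i * w s 0 i) =
    \sum_(i < N) (fun s => u s 0 i) * (fun s => w s 0 i).
  by apply/funext => s; rewrite fct_sumE.
rewrite -big_split /=; apply: is_derive_sum => i.
have H := is_deriveM (is_derive_coord i ud) (is_derive_coord i wd).
by apply: (is_derive_eq H); rewrite addrC [w t 0 i *: _]mulrC.
Qed.

Lemma is_derive_potential (V : 'rV[R]_N -> R) u (t : R) du :
  differentiable V (u t) -> is_derive t 1 u du ->
  is_derive t 1 (V \o u) (edot du (gradient V (u t))).
Proof.
move=> dV ud.
have du' : differentiable u t by apply/derivable1_diffP.
have dVu : differentiable (V \o u) t by exact: differentiable_comp.
apply: DeriveDef; first exact/derivable1_diffP.
rewrite deriveE// diff_comp//= -(deriveE _ du') derive_val.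
rewrite [in LHS](row_sum_delta du) linear_sum /edot; apply: eq_bigr => i _.
by rewrite linearZ /= mxE deriveE.
Qed.

Lemma is_derive_rev (E : normedModType R) (u : R -> E) (t : R) du :
  is_derive (- t) 1 u du -> is_derive t 1 (fun s => u (- s)) (- du).
Proof.
move=> ud.
have du' : differentiable u (- t) by apply/derivable1_diffP.
have dN : differentiable (-%R : R -> R) t by [].
have dVu : differentiable (u \o -%R) t by exact: differentiable_comp.
apply: (@DeriveDef _ _ _ _ _ (u \o -%R)); first exact/derivable1_diffP.
rewrite deriveE// diff_comp//= -(deriveE _ dN) derive_val.
by rewrite linearN -(deriveE _ du') derive_val.
Qed.

Lemma is_derive_pair (E F : normedModType R) (y : R -> E * F) (t : R) g :
  is_derive t 1 y g ->
  is_derive t 1 (fun s => (y s).1) g.1 /\ is_derive t 1 (fun s => (y s).2) g.2.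
Proof.
move=> [yd yg].
have lim : h^-1 *: (y (h *: 1 + t) - y t) @[h --> 0^'] --> g.
  by rewrite -yg; exact: yd.
have l1 : h^-1 *: ((y (h *: 1 + t)).1 - (y t).1) @[h --> 0^'] --> g.1.
  exact: (cvg_comp _ _ lim (@cvg_fst _ _ (nbhs g.1) (nbhs g.2) _)).
have l2 : h^-1 *: ((y (h *: 1 + t)).2 - (y t).2) @[h --> 0^'] --> g.2.
  exact: (cvg_comp _ _ lim (@cvg_snd _ _ (nbhs g.1) (nbhs g.2) _)).
split; apply: DeriveDef.
- by apply/cvg_ex; exists g.1.
- exact: cvg_lim l1.
- by apply/cvg_ex; exists g.2.
- exact: cvg_lim l2.
Qed.

Lemma compact_ball_pair (r : R) :
  compact [set p : 'rV[R]_N * 'rV[R]_N | `|p| <= r].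
Proof.
have cr : compact [set x : 'rV[R]_N | `|x| <= r].
  apply: bounded_closed_compact.
    exists r; split; first exact: num_real.
    by move=> M rM x /= xr; rewrite (le_trans xr)// ltW.
  exact: (closed_comp (fun x _ => @norm_continuous R 'rV[R]_N x) (@closed_le R r)).
have := compact_setX cr cr; congr (compact _).
by apply/seteqP; split=> p /=; rewrite prod_normE ge_max => /andP.
Qed.

End EuclideanCalculus.

Section RealCalculus.
Variable R : realType.
Implicit Types (f p q w m : R -> R) (c T : R).

Lemma is_derive_cvg (E : normedModType R) (f : R -> E) (t : R) df :
  is_derive t 1 f df -> {for t, continuous f}.
Proof.
by move=> fd; apply: differentiable_continuous; apply/derivable1_diffP.
Qed.

Lemma derive_ge0_le f f' T : 0 <= T ->
  (forall t, 0 <= t <= T -> is_derive t 1 f (f' t)) ->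
  (forall t, 0 <= t <= T -> 0 <= f' t) -> f 0 <= f T.
Proof.
move=> T0 fd f'0.
have [||c] := @MVT_segment R f f' 0 T T0.
- by move=> t; rewrite in_itv /= => /andP[? ?]; apply: fd; apply/andP; split; exact: ltW.
- apply/continuous_in_subspaceT => t; rewrite inE /= in_itv /= => /fd.
  exact: is_derive_cvg.
rewrite in_itv /= => /f'0 c0 fT.
by rewrite -subr_ge0 fT mulr_ge0// subr0.
Qed.

Lemma derive_eq0_cst f T : 0 <= T ->
  (forall t, 0 <= t <= T -> is_derive t 1 f 0) -> f T = f 0.
Proof.
move=> T0 fd; apply/eqP; rewrite eq_le; apply/andP; split; last first.
  exact: (@derive_ge0_le f (fun _ => 0)).
rewrite -lerN2; apply: (@derive_ge0_le (- f) (fun _ => 0)) => // t /fd fd0.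
by have := is_deriveN fd0; rewrite oppr0.
Qed.

(** Taylor's lower bound of order two at a critical point. *)
Lemma convex_growth q p w c T : 0 <= T ->
  (forall t, 0 <= t <= T -> is_derive t 1 q (p t)) ->
  (forall t, 0 <= t <= T -> is_derive t 1 p (w t)) ->
  p 0 = 0 -> (forall t, 0 <= t <= T -> c <= w t) ->
  q 0 + c / 2 * T ^+ 2 <= q T.
Proof.
move=> T0 qd pd p0 cw.
have pge t : 0 <= t <= T -> c * t <= p t.
  move=> /andP[t0 tT].
  have sub s : 0 <= s <= t -> 0 <= s <= T.
    by move=> /andP[-> /le_trans]; exact.
  have := @derive_ge0_le (p - (fun s => c * s)) (fun s => w s - c) t t0.
  rewrite /= !fctE p0 mulr0 subr0 subr_ge0; apply.
  - move=> s /sub/pd ps; apply: is_deriveB.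
    have := is_deriveZ c (is_derive_id s (1 : R)).
    by rewrite /GRing.scale /= mulr1.
  - by move=> s /sub/cw; rewrite subr_ge0.
have := @derive_ge0_le (q - (fun s => c / 2 * s ^+ 2)) (fun s => p s - c * s) T T0.
rewrite /= !fctE expr0n mulr0 subr0 lerBrDr; apply.
- move=> s /qd qs; apply: is_deriveB.
  have H := is_deriveZ (c / 2) (is_deriveM (is_derive_id s (1 : R)) (is_derive_id s 1)).
  by apply: (is_derive_eq H); rewrite /GRing.scale /=; lra.
- by move=> s /pge; rewrite subr_ge0.
Qed.

(** Let T be the infimum of the times where m <= 0.  By continuity m >= 0 on
    [0, T], so the hypothesis gives m > 0 at T and hence near T, against the
    choice of T. *)
Lemma positive_of_first_exit m : continuous m -> 0 < m 0 ->
  (forall T, 0 <= T -> (forall s, 0 <= s <= T -> 0 <= m s) -> 0 < m T) ->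
  forall t, 0 <= t -> 0 < m t.
Proof.
move=> mc m0 mT t t0; rewrite ltNge; apply/negP => mt.
pose S := [set s | 0 <= s /\ m s <= 0].
have iS : has_inf S by split; [exists t | exists 0 => s []].
have T0 : 0 <= inf S by apply: lb_le_inf => [|s []//]; exists t.
have pre s : 0 <= s -> s < inf S -> 0 < m s.
  move=> s0; rewrite [0 < _]ltNge; apply: contraTN => ms; rewrite -leNgt.
  by apply: ge_inf => //; exists 0 => r [].
have : 0 < m (inf S).
  apply: mT => // s /andP[s0]; rewrite le_eqVlt => /predU1P[->|]; last first.
    by move=> /(pre _ s0)/ltW.
  rewrite leNgt; apply/negP => mneg.
  have [e /= e0 em] : \forall s \near inf S, m s < 0.
    by apply: (cvgr_lt _ (mc (inf S))).
  have Tpos : 0 < inf S.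
    rewrite lt_neqAle T0 andbT; apply/eqP => eq0.
    by move: mneg; rewrite -eq0 ltNge (ltW m0).
  pose s1 := Num.max 0 (inf S - e / 2).
  have s1T : s1 < inf S by rewrite gt_max Tpos /= gtrDl oppr_lt0 divr_gt0.
  have := pre s1; rewrite le_max lexx => /(_ isT s1T).
  apply/negP; rewrite -leNgt ltW// em//= /ball_/=.
  rewrite ger0_norm ?subr_ge0 ?ltW//.
  have : inf S - e / 2 <= s1 by rewrite le_max lexx orbT.
  lra.
move=> mpos.
have [e /= e0 em] : \forall s \near inf S, 0 < m s.
  by apply: (cvgr_gt _ (mc (inf S))).
have [s [s0 ms] se] := inf_adherent e0 iS.
have Ss : inf S <= s by apply: ge_inf => //; exists 0 => r [].
have : 0 < m s by apply: em; rewrite /= distrC ger0_norm ?subr_ge0//; lra.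
by rewrite ltNge ms.
Qed.

End RealCalculus.

Lemma cvg_min (R : realType) (T : Type) (F : set_system T) {FF : Filter F}
    (f g : T -> R) (l m : R) :
  f s @[s --> F] --> l -> g s @[s --> F] --> m ->
  Num.min (f s) (g s) @[s --> F] --> Num.min l m.
Proof.
by move=> fl gm; exact: (cvg_comp2 fl gm (@min_continuous _ R (l, m))).
Qed.

Lemma cvg_max (R : realType) (T : Type) (F : set_system T) {FF : Filter F}
    (f g : T -> R) (l m : R) :
  f s @[s --> F] --> l -> g s @[s --> F] --> m ->
  Num.max (f s) (g s) @[s --> F] --> Num.max l m.
Proof.
by move=> fl gm; exact: (cvg_comp2 fl gm (@max_continuous _ R (l, m))).
Qed.

(** * The cut-off system and its escaping orbits *)

Section Escape.
Variables (R : realType) (N : nat) (V : 'rV[R]_N -> R) (H a : R).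
Implicit Types (t T : R) (x v : 'rV[R]_N).

(** The bounds on |x|^2 and |v|^2 along the orbit issued from |x|^2 = a + 2,
    relaxed: convexity gives a + 2 <= |x|^2 <= a + 2 + 3 H t^2, and the energy
    with |V| < 1 gives |v|^2 <= 2 H + 2.  The room left makes the first-exit
    argument strict. *)
Definition margin t x v : R :=
  Num.min (Num.min (edot x x - (a + 1)) (a + 4 + 3 * H * t ^+ 2 - edot x x))
          (2 * H + 3 - edot v v).

(** Equal to 1 where the margin is nonnegative, to 0 where it is at most -1; the
    latter region contains, for a > 0, a neighborhood of the singularity x = 0. *)
Definition cutoff t x v : R := Num.max 0 (Num.min 1 (1 + margin t x v)).

Definition cut_field t (p : 'rV[R]_N * 'rV[R]_N) : 'rV[R]_N * 'rV[R]_N :=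
  cutoff t p.1 p.2 *: (p.2, - gradient V p.1).

Lemma margin_ge t x v (c : R) : (c <= margin t x v) =
  [&& c <= edot x x - (a + 1), c <= a + 4 + 3 * H * t ^+ 2 - edot x x
    & c <= 2 * H + 3 - edot v v].
Proof. by rewrite !le_min andbA. Qed.

Lemma margin_gt t x v (c : R) : (c < margin t x v) =
  [&& c < edot x x - (a + 1), c < a + 4 + 3 * H * t ^+ 2 - edot x x
    & c < 2 * H + 3 - edot v v].
Proof. by rewrite !lt_min andbA. Qed.

Lemma margin_rev t x v : margin (- t) x (- v) = margin t x v.
Proof. by rewrite /margin sqrrN edotNl edotNr opprK. Qed.

Lemma cutoff1 t x v : 0 <= margin t x v -> cutoff t x v = 1.
Proof.
move=> m0; rewrite /cutoff min_l ?lerDl//.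
by rewrite max_r.
Qed.

Lemma cutoff0 t x v : margin t x v <= -1 -> cutoff t x v = 0.
Proof.
move=> m0; rewrite /cutoff min_r; last lra.
by rewrite max_l//; lra.
Qed.

Lemma cvg_margin (T : Type) (F : set_system T) {FF : Filter F}
    (f : T -> R) (g h : T -> 'rV[R]_N) t x v :
  f s @[s --> F] --> t -> g s @[s --> F] --> x -> h s @[s --> F] --> v ->
  margin (f s) (g s) (h s) @[s --> F] --> margin t x v.
Proof.
move=> ft gx hv.
have gxx : edot (g s) (g s) @[s --> F] --> edot x x by exact: cvg_edot.
have hvv : edot (h s) (h s) @[s --> F] --> edot v v by exact: cvg_edot.
rewrite /margin; apply: cvg_min; [apply: cvg_min|].
- by apply: cvgB => //; exact: cvg_cst.
- apply: cvgB gxx; apply: cvgD; first exact: cvg_cst.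
  apply: cvgM; first exact: cvg_cst.
  exact: cvgM.
- by apply: cvgB => //; exact: cvg_cst.
Qed.

Hypothesis a0 : 0 < a.
Hypothesis hC1 : C1_punctured V.

Lemma cut_field_continuous :
  continuous (fun p : R * ('rV[R]_N * 'rV[R]_N) => cut_field p.1 p.2).
Proof.
move=> [t [x v]].
have c1 : p.1 @[p --> (t, (x, v))] --> t by exact: cvg_fst.
have c2 : p.2 @[p --> (t, (x, v))] --> (x, v) by exact: cvg_snd.
have cx : p.2.1 @[p --> (t, (x, v))] --> x by exact: (cvg_comp _ _ c2 cvg_fst).
have cv : p.2.2 @[p --> (t, (x, v))] --> v by exact: (cvg_comp _ _ c2 cvg_snd).
have cm : margin p.1 p.2.1 p.2.2 @[p --> (t, (x, v))] --> margin t x v.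
  exact: cvg_margin.
have [x0|xN0] := eqVneq x 0.
  (* near the singularity the cutoff vanishes, because a is positive *)
  apply: (near_cst_continuous (0 : 'rV[R]_N * 'rV[R]_N)).
  have mneg : margin t x v < -1.
    rewrite /margin !gt_min x0 edot0l; apply/orP; left; apply/orP; left.
    by move: a0; lra.
  apply: filterS (cvgr_lt _ cm _ mneg) => p mp.
  by rewrite /cut_field cutoff0 ?scale0r// ltW.
rewrite /continuous_at /cut_field /=; apply: cvgZ.
  apply: cvg_max; first exact: cvg_cst.
  apply: cvg_min; first exact: cvg_cst.
  by apply: cvgD; first exact: cvg_cst.
have cg : - gradient V p.2.1 @[p --> (t, (x, v))] --> - gradient V x.
  by apply: cvgN; exact: (cvg_comp _ _ cx (hC1 xN0).2).
exact: (@cvg_pair _ _ _ _ (nbhs v) (nbhs (- gradient V x)) _ _ _ _ _ cv cg).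
Qed.

Lemma cut_field_support T : exists B, forall t p,
  `|t| <= T -> B < `|p| -> cut_field t p = 0.
Proof.
exists (1 + (a + 5 + 3 * `|H| * T ^+ 2 + (2 * `|H| + 4))) => t [x v] tT.
rewrite prod_normE /= => Bp; rewrite /cut_field cutoff0 ?scale0r//=.
rewrite leNgt margin_gt; apply/negP => /and3P[_ qx qv].
have T2 : t ^+ 2 <= T ^+ 2.
  by rewrite -real_normK ?num_real// lerXn2r ?nnegrE// (le_trans _ tT).
have Ht : H * t ^+ 2 <= `|H| * T ^+ 2.
  apply: le_trans (ler_norm _) _; rewrite normrM [`|t ^+ 2|]ger0_norm ?sqr_ge0//.
  by rewrite ler_wpM2l.
have HH := ler_norm H.
have HT : 0 <= `|H| * T ^+ 2 by rewrite mulr_ge0 ?sqr_ge0.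
have nH := normr_ge0 H.
have := norm_le_edot x; have := norm_le_edot v.
by move: Bp a0; rewrite lt_max => /orP[]; lra.
Qed.

Hypothesis H0 : 0 < H.
Hypothesis far : forall x, a < edot x x ->
  `|2 * V x + edot x (gradient V x)| < H /\ `|V x| < 1.

Section Orbit.
Variables u v : R -> 'rV[R]_N.
Hypothesis ud : forall t : R,
  is_derive t 1 u (cutoff t (u t) (v t) *: v t).
Hypothesis vd : forall t : R,
  is_derive t 1 v (cutoff t (u t) (v t) *: - gradient V (u t)).
Hypothesis u0 : edot (u 0) (u 0) = a + 2.
Hypothesis uv0 : edot (u 0) (v 0) = 0.
Hypothesis E0 : 2^-1 * edot (v 0) (v 0) + V (u 0) = H.

(** While the margin is nonnegative the orbit solves the true system: energy is
    conserved, and 2 H <= (|u|^2)'' <= 6 H with (|u|^2)' = 0 at time 0. *)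
Lemma a_priori T : 0 <= T ->
  (forall t, 0 <= t <= T -> 0 <= margin t (u t) (v t)) ->
  [/\ 2^-1 * edot (v T) (v T) + V (u T) = H,
      a + 2 + H * T ^+ 2 <= edot (u T) (u T)
    & edot (u T) (u T) <= a + 2 + 3 * H * T ^+ 2].
Proof.
move=> T0 m0.
have ud1 t : 0 <= t <= T -> is_derive t 1 u (v t).
  by move=> /m0/cutoff1 c1; have := ud t; rewrite c1 scale1r.
have vd1 t : 0 <= t <= T -> is_derive t 1 v (- gradient V (u t)).
  by move=> /m0/cutoff1 c1; have := vd t; rewrite c1 scale1r.
have ufar t : 0 <= t <= T -> a < edot (u t) (u t).
  by move=> /m0; rewrite margin_ge => /and3P[]; lra.
have uN0 t : 0 <= t <= T -> u t != 0.
  by move=> /ufar; apply: contraTneq => ->; rewrite edot0l -leNgt ltW.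
have En t : 0 <= t <= T -> 2^-1 * edot (v t) (v t) + V (u t) = H.
  move=> /andP[t0 tT]; rewrite -E0.
  apply: (@derive_eq0_cst R (fun s => 2^-1 * edot (v s) (v s) + V (u s)) t t0).
  move=> s /andP[s0 st]; have sT : 0 <= s <= T by rewrite s0 (le_trans st).
  have D1 := is_deriveZ 2^-1 (is_derive_edot (vd1 _ sT) (vd1 _ sT)).
  have D2 := is_derive_potential (hC1 (uN0 _ sT)).1 (ud1 _ sT).
  apply: (is_derive_eq (is_deriveD D1 D2)).
  rewrite /GRing.scale /= edotNl edotNr [edot (gradient _ _) _]edotC; lra.
have qd t : 0 <= t <= T ->
    is_derive t 1 (fun s => edot (u s) (u s)) (2 * edot (u t) (v t)).
  move=> tT; apply: (is_derive_eq (is_derive_edot (ud1 _ tT) (ud1 _ tT))).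
  by rewrite edotC; lra.
have pd t : 0 <= t <= T -> is_derive t 1 (fun s => 2 * edot (u s) (v s))
    (2 * (2 * H - (2 * V (u t) + edot (u t) (gradient V (u t))))).
  move=> tT.
  apply: (is_derive_eq (is_deriveZ 2 (is_derive_edot (ud1 _ tT) (vd1 _ tT)))).
  by rewrite /GRing.scale /= edotNr; have := En t tT; lra.
have p0 : 2 * edot (u 0) (v 0) = 0 by rewrite uv0 mulr0.
split; first by apply: En; rewrite T0 lexx.
- rewrite -u0; have -> : H = 2 * H / 2 by field.
  apply: (@convex_growth R (fun s => edot (u s) (u s)) _ _ (2 * H) T T0 qd pd p0).
  by move=> t /ufar/far[]; rewrite ltr_norml => /andP[_ ?] _; lra.
- have qdN t : 0 <= t <= T ->
      is_derive t 1 (- (fun s => edot (u s) (u s))) (- (2 * edot (u t) (v t))).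
    by move=> /qd ?; exact: is_deriveN.
  have pdN t : 0 <= t <= T -> is_derive t 1 (fun s => - (2 * edot (u s) (v s)))
      (- (2 * (2 * H - (2 * V (u t) + edot (u t) (gradient V (u t)))))).
    by move=> /pd ?; exact: is_deriveN.
  have p0N : - (2 * edot (u 0) (v 0)) = 0 by rewrite p0 oppr0.
  have := @convex_growth R _ _ _ (- (6 * H)) T T0 qdN pdN p0N.
  rewrite !fctE u0 => le.
  suff : - (a + 2) + - (6 * H) / 2 * T ^+ 2 <= - edot (u T) (u T) by lra.
  apply: le => t /ufar/far[]; rewrite ltr_norml => /andP[? _] _; lra.
Qed.

Lemma margin_pos T : 0 <= T -> 0 < margin T (u T) (v T).
Proof.
apply: (@positive_of_first_exit R (fun t => margin t (u t) (v t))).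
- by move=> t; apply: cvg_margin; [exact: cvg_id|exact: is_derive_cvg (ud t)|
    exact: is_derive_cvg (vd t)].
- have := E0; have := H0.
  rewrite margin_gt u0 expr0n mulr0.
  have [] := far (x := u 0); first by rewrite u0; lra.
  rewrite ltr_norml => _; rewrite ltr_norml => /andP[? _] H0' E0'.
  by apply/and3P; split; lra.
- move=> t t0 /(a_priori t0)[En lo up].
  have Ht : 0 <= H * t ^+ 2 by rewrite mulr_ge0 ?sqr_ge0// ltW.
  have [] := far (x := u t); first lra.
  rewrite ltr_norml => _; rewrite ltr_norml => /andP[? _].
  by rewrite margin_gt; apply/and3P; split; lra.
Qed.

Lemma escape T : 0 <= T ->
  cutoff T (u T) (v T) = 1 /\
  [/\ 2^-1 * edot (v T) (v T) + V (u T) = H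
    & a + 2 + H * T ^+ 2 <= edot (u T) (u T)].
Proof.
move=> T0; have mp t : 0 <= t -> 0 <= margin t (u t) (v t).
  by move=> /margin_pos/ltW.
split; first by apply: cutoff1; exact: mp.
by have [] := a_priori T0 (fun t tT => mp t (andP tT).1).
Qed.

End Orbit.
End Escape.

(** * Existence of a hyperbolic orbit *)

(** By energy conservation and V < 0 the speed is at least sqrt(2 H) everywhere,
    so hyperbolicity only asks for |u| to go to infinity. *)
Lemma hyperbolic_of_growth (R : realType) (N : nat) (V : 'rV[R]_N -> R)
    (H c : R) (u v : R -> 'rV[R]_N) :
  C1_punctured V -> (forall x, x != 0 -> V x < 0) -> 0 < H -> 0 < c ->
  (forall t : R, is_derive t 1 u (v t)) ->
  (forall t : R, is_derive t 1 v (- gradient V (u t))) ->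
  (forall t, 2^-1 * edot (v t) (v t) + V (u t) = H) ->
  (forall t, c + H * t ^+ 2 <= edot (u t) (u t)) ->
  hyperbolic_orbit V H u.
Proof.
move=> hC1 Vneg H0 c0 ud vd En qge.
have du : derive1 u = v.
  by apply/funext => t; rewrite derive1E; exact: derive_val.
have ddu : derive1n 2 u = (fun t => - gradient V (u t)).
  by apply/funext => t; rewrite derive1nS derive1n1 du derive1E; exact: derive_val.
have uN0 t : u t != 0.
  have Ht : 0 <= H * t ^+ 2 by rewrite mulr_ge0 ?sqr_ge0// ltW.
  by apply/eqP => ut; have := qge t; rewrite ut edot0l; lra.
split.
- split => //.
  + split=> //; first by rewrite du.
    rewrite ddu => t; apply: cvgN.
    exact: (cvg_comp _ _ (is_derive_cvg (ud t)) (hC1 _ (uN0 t)).2).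
  + by move=> t; rewrite ddu addNr.
  + by move=> t; rewrite du sqr_enorm.
- apply/cvgryPge => A; exists (A ^+ 2 / H + 1) => //= t /= tA.
  apply: le_trans (ler_norm A) _; rewrite -sqrtr_sqr /enorm ler_sqrt ?edot_ge0//.
  apply: le_trans (qge t).
  have HA : A ^+ 2 / H * H = A ^+ 2 by rewrite divfK// gt_eqF.
  have A0 : 0 <= A ^+ 2 / H by rewrite divr_ge0 ?sqr_ge0// ltW.
  have t2 : A ^+ 2 / H <= t ^+ 2.
    rewrite -[t ^+ 2]real_normK ?num_real//; nra.
  rewrite -HA mulrC; have : H * (A ^+ 2 / H) <= H * t ^+ 2 by rewrite ler_pM2l.
  lra.
- rewrite limf_einfE du; apply: (@lt_le_trans _ _ (Num.sqrt (2 * H))%:E).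
    by rewrite lte_fin sqrtr_gt0 mulr_gt0.
  apply: le_trans (ereal_sup_ubound _); last first.
    exists setT; first exact: filterT.
    reflexivity.
  apply: le_ereal_inf_tmp => _ [t _ <-]; rewrite lee_fin /enorm ler_sqrt ?edot_ge0//.
  have := En t; have := Vneg _ (uN0 t); lra.
Qed.

Lemma far_region (R : realType) (N : nat) (V : 'rV[R]_N -> R) (H : R) :
  2 * V x + edot x (gradient V x) @[x --> norm_infty (@enorm R N)] --> (0 : R) ->
  V x @[x --> norm_infty (@enorm R N)] --> (0 : R) -> 0 < H ->
  exists2 a : R, 0 < a & forall x, a < edot x x ->
    `|2 * V x + edot x (gradient V x)| < H /\ `|V x| < 1.
Proof.
move=> V3 V6 H0.
have /cvgr0Pnorm_lt/(_ H H0) [M _ farM] := V3.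
have /cvgr0Pnorm_lt/(_ 1 ltr01) [M' _ farM'] := V6.
pose r := Num.max 1 (Num.max M M').
have r1 : 1 <= r by rewrite le_max lexx.
have r0 : 0 <= r by lra.
exists (r ^+ 2); first by rewrite exprn_gt0//; lra.
move=> x rx.
have xr : r < enorm x.
  rewrite -(ger0_norm r0) -sqrtr_sqr /enorm ltr_sqrt//.
  exact: le_lt_trans (sqr_ge0 _) rx.
by split; [apply: farM|apply: farM'] => /=; apply: le_lt_trans xr;
  rewrite !le_max lexx ?orbT.
Qed.

(** Two orthogonal coordinate axes carry the position and the velocity; the
    speed is prescribed by the energy. *)
Lemma tangential_data (R : realType) (N : nat) (V : 'rV[R]_N -> R) (H b : R) :
  (2 <= N)%N -> 0 <= b -> (forall x : 'rV[R]_N, edot x x = b -> V x <= H) ->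
  exists x v : 'rV[R]_N, [/\ edot x x = b, edot x v = 0 &
    2^-1 * edot v v + V x = H].
Proof.
move=> N2 b0 VH.
have N0 : (0 < N)%N by exact: ltnW.
pose e i : 'rV[R]_N := delta_mx 0 i.
pose i0 := Ordinal N0; pose i1 := Ordinal N2.
pose x := Num.sqrt b *: e i0.
have xx : edot x x = b.
  by rewrite edotZl edotC edotZl edot_delta eqxx mulr1 -expr2 sqr_sqrtr.
exists x, (Num.sqrt (2 * (H - V x)) *: e i1); split=> //.
  by rewrite edotZl edotC edotZl edot_delta !mulr0.
rewrite edotZl edotC edotZl edot_delta eqxx mulr1 -expr2 sqr_sqrtr; last first.
  by rewrite mulr_ge0// subr_ge0 VH.
by field.
Qed.

Theorem theorem1p5 (R : realType) (N : nat) (V : 'rV[R]_N -> R)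
  (hN : (2 <= N)%N)
  (hC1 : C1_punctured V)
  (V1 : forall x : 'rV[R]_N, x != 0 -> V (- x) = V x)
  (V2 : forall x : 'rV[R]_N, x != 0 -> V x < 0)
  (V3 : 2 * V x + edot x (gradient V x)
          @[x --> norm_infty (@enorm R N)] --> (0 : R))
  (V4 : 2 * V x + edot x (gradient V x) @[x --> (0 : 'rV[R]_N)^'] --> +oo)
  (V5 : - V x @[x --> (0 : 'rV[R]_N)^'] --> +oo)
  (V6 : V x @[x --> norm_infty (@enorm R N)] --> (0 : R)) :
  forall H : R, 0 < H ->
    exists u : R -> 'rV[R]_N, hyperbolic_orbit V H u.
Proof.
move=> H H0.
have [a a0 far] := far_region V3 V6 H0.
have neg x : a < edot x x -> V x < 0.
  move=> ax; apply: V2; apply: contraTneq ax => ->.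
  by rewrite edot0l -leNgt ltW.
have [x0 [v0 [xx xv En0]]] : exists x v : 'rV[R]_N,
    [/\ edot x x = a + 2, edot x v = 0 & 2^-1 * edot v v + V x = H].
  apply: tangential_data => // [|x xa]; first lra.
  by have := @neg x; rewrite xa; lra.
have [y y0 yd] := peano (x0, v0) (@compact_ball_pair R N)
  (@cut_field_continuous R N V H a a0 hC1) (@cut_field_support R N V H a a0).
pose u (t : R) : 'rV[R]_N := (y t).1; pose v (t : R) : 'rV[R]_N := (y t).2.
have ud (t : R) : is_derive t 1 u (cutoff H a t (u t) (v t) *: v t).
  by have [] := is_derive_pair (yd t).
have vd (t : R) : is_derive t 1 v (cutoff H a t (u t) (v t) *: - gradient V (u t)).
  by have [] := is_derive_pair (yd t).
have u0 : u 0 = x0 by rewrite /u y0.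
have v0' : v 0 = v0 by rewrite /v y0.
have fwd T : 0 <= T -> cutoff H a T (u T) (v T) = 1 /\
    [/\ 2^-1 * edot (v T) (v T) + V (u T) = H
      & a + 2 + H * T ^+ 2 <= edot (u T) (u T)].
  by apply: (@escape R N V H a a0 hC1 H0 far u v ud vd); rewrite ?u0 ?v0'.
(* (u (- t), - v (- t)) solves the same cut-off system, since the margin is
   even in t and in v *)
have bwd T : 0 <= T -> cutoff H a (- T) (u (- T)) (v (- T)) = 1 /\
    [/\ 2^-1 * edot (v (- T)) (v (- T)) + V (u (- T)) = H
      & a + 2 + H * T ^+ 2 <= edot (u (- T)) (u (- T))].
  have cutR t : cutoff H a t (u (- t)) (- v (- t)) =
      cutoff H a (- t) (u (- t)) (v (- t)).
    by rewrite /cutoff -{1}[t]opprK margin_rev.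
  move=> T0; rewrite -cutR -[edot (v _) _]opprK -edotNl -edotNr.
  apply: (@escape R N V H a a0 hC1 H0 far
    (fun t => u (- t)) (fun t => - v (- t))) => //.
  - move=> t; rewrite cutR scalerN; exact: is_derive_rev.
  - move=> t; rewrite cutR scalerN -[X in is_derive _ _ _ X]opprK.
    rewrite -scalerN; exact: is_deriveN (is_derive_rev (vd (- t))).
  - by rewrite oppr0 u0.
  - by rewrite oppr0 u0 v0' edotNr xv oppr0.
  - by rewrite oppr0 u0 v0' edotNl edotNr opprK.
have orbit t : cutoff H a t (u t) (v t) = 1 /\
    [/\ 2^-1 * edot (v t) (v t) + V (u t) = H
      & a + 2 + H * t ^+ 2 <= edot (u t) (u t)].
  have [t0|t0] := leP 0 t; first exact: fwd.
  by have := bwd (- t); rewrite opprK sqrrN; apply; rewrite oppr_ge0 ltW.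
exists u; apply: (@hyperbolic_of_growth R N V H (a + 2) u v) => //; first lra.
- by move=> t; have := ud t; rewrite (orbit t).1 scale1r.
- by move=> t; have := vd t; rewrite (orbit t).1 scale1r.
- by move=> t; have [_ []] := orbit t.
- by move=> t; have [_ []] := orbit t.
Qed.
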